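(* For $\theta\in(0,\pi)$ let $\rho^{Ry}_\theta=|\psi^{Ry}_\theta\rangle\langle\psi^{Ry}_\theta|$ and $\rho^{Rx}_\theta=|\psi^{Rx}_\theta\rangle\langle\psi^{Rx}_\theta|$ with $|\psi^{Ry}_\theta\rangle=\cos\tfrac\theta2|00\rangle+\sin\tfrac\theta2|11\rangle$ and $|\psi^{Rx}_\theta\rangle=\cos\tfrac\theta2|00\rangle-i\sin\tfrac\theta2|11\rangle$. Then for all $\theta\in(0,\pi)$ (with $n=2$): $$C(\rho^{Ry}_\theta)=|\sin\theta|+|\cos\theta|-1,\qquad C(\rho^{Rx}_\theta)=\tfrac12\bigl(|\sin\theta|+|\cos\theta|-1\bigr),$$ $$\Gamma(\rho^{Ry}_\theta)=\Gamma(\rho^{Rx}_\theta)=|\sin\theta|+|\cos\theta|,$$ and hence, whenever $C>0$, $\kappa(\rho^{Ry}_\theta)=1$ and $\kappa(\rho^{Rx}_\theta)=2$.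
   Context: Let $I,X,Y,Z$ be the Pauli matrices. For $(q,p)\in\mathbb{F}_2^2$ define the single-qubit phase-point operator $A_{(q,p)}=\tfrac12\bigl(I+(-1)^pX+(-1)^{q+p}Y+(-1)^qZ\bigr)$. For $n$ qubits and $\alpha=(\alpha_1,\dots,\alpha_n)\in(\mathbb{F}_2^2)^n$ set $A_\alpha=A_{\alpha_1}\otimes\cdots\otimes A_{\alpha_n}$. The discrete Wigner function of an $n$-qubit operator $\rho$ is $W_\rho(\alpha)=2^{-n}\mathrm{Tr}(\rho A_\alpha)$, regarded as a vector in $\mathbb{R}^{4^n}$. $\mathrm{Stab}_n$ denotes the set of pure $n$-qubit stabilizer states, i.e. density operators $|\psi\rangle\langle\psi|$ with $|\psi\rangle$ the unique common $+1$ eigenvector of an abelian subgroup of the $n$-qubit Pauli group of size $2^n$ (not containing $-I$). The free Wigner polytope is $\mathcal{W}_{\mathrm{free}}=\mathrm{conv}\{W_\sigma:\sigma\in\mathrm{Stab}_n\}$, and the Wigner distance is $C(\rho)=\min_{f\in\mathcal{W}_{\mathrm{free}}}\|W_\rho-f\|_1$. The stabilizer extent (for mixed states) is $\Gamma(\rho)=\min\{\sum_i|\alpha_i|:\rho=\sum_i\alpha_i\sigma_i,\ \alpha_i\in\mathbb{R},\ \sigma_i\in\mathrm{Stab}_n\}$ (finite sums). For $C(\rho)>0$ the tightness ratio is $\kappa(\rho)=(\Gamma(\rho)-1)/C(\rho)$. *)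

(* Defs.v *)
From HB Require Import structures.
From mathcomp Require Import all_boot all_order all_algebra.
From mathcomp Require Import boolp classical_sets reals trigo.
From mathcomp Require complex mxtens.
Import complex.
Set Implicit Arguments. Unset Strict Implicit. Unset Printing Implicit Defensive.
Import Order.TTheory GRing.Theory Num.Theory.
Local Open Scope ring_scope.

Section Defs.
Variable R : realType.
Local Notation C := (complex.complex R).
Local Notation "A *t B" := (mxtens.tensmx A B) (at level 40, left associativity).

Definition iC : C := complex.Complex 0 1.
Definition rC (x : R) : C := complex.Complex x 0.

(* single-qubit Pauli matrices (computational basis |0>,|1> = indices 0,1) *)
Definition pI : 'M[C]_2 := 1%:M.
Definition pX : 'M[C]_2 := \matrix_(i < 2, j < 2) (if i != j then 1 else 0).
Definition pY : 'M[C]_2 :=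
  \matrix_(i < 2, j < 2) (if i == j then 0 else if (i : nat) == 0%N then - iC else iC).
Definition pZ : 'M[C]_2 :=
  \matrix_(i < 2, j < 2) (if i == j then (if (i : nat) == 0%N then 1 else -1) else 0).

Inductive pauli := PI | PX | PY | PZ.
Definition pauli_mx (p : pauli) : 'M[C]_2 :=
  match p with PI => pI | PX => pX | PY => pY | PZ => pZ end.

(* two-qubit operators: 'M_(2*2) = 'M_4, index of |ab> is 2a+b *)
Local Notation Mat := (matrix C (2 * 2) (2 * 2)).

Definition pauli_group2 (M : Mat) : Prop :=
  exists (k : nat) (p1 p2 : pauli), M = iC ^+ k *: (pauli_mx p1 *t pauli_mx p2).

Definition dagger m n (A : 'M[C]_(m, n)) : 'M[C]_(n, m) :=
  map_mx (fun z : C => complex.conjc z) A^T.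

Definition stabilizer_group (S : seq Mat) : Prop :=
  [/\ uniq S, size S = 4%N,
      (forall g, g \in S -> pauli_group2 g),
      (1%:M \in S) &
      (forall g h, g \in S -> h \in S -> g *m h \in S)] /\ [/\
      (forall g, g \in S -> exists2 h, h \in S & g *m h = 1%:M),
      (forall g h, g \in S -> h \in S -> g *m h = h *m g)
    & (- 1%:M \notin S)].

Definition stab_state (sigma : Mat) : Prop :=
  exists (S : seq Mat) (psi : 'cV[C]_(2 * 2)),
    [/\ stabilizer_group S,
        dagger psi *m psi = 1%:M,
        (forall g, g \in S -> g *m psi = psi),
        (forall phi : 'cV[C]_(2 * 2), (forall g, g \in S -> g *m phi = phi) ->
            exists c : C, phi = c *: psi)
      & sigma = psi *m dagger psi].

Definition sgnb (b : bool) : C := if b then -1 else 1.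
Definition A1 (qp : bool * bool) : 'M[C]_2 :=
  let: (q, p) := qp in
  (rC (2^-1)) *: (pI + sgnb p *: pX + sgnb (q (+) p) *: pY + sgnb q *: pZ).
Definition phase_point (a : (bool * bool) * (bool * bool)) : Mat :=
  A1 a.1 *t A1 a.2.

(* discrete Wigner function W_rho(alpha) = 2^-2 Tr(rho A_alpha) (a real number
   for Hermitian rho; we take its real part) *)
Definition wigner (rho : Mat) (a : (bool * bool) * (bool * bool)) : R :=
  complex.Re (\tr (rho *m phase_point a)) / 4%:R.

Definition l1dist (f g : (bool * bool) * (bool * bool) -> R) : R :=
  \sum_(a : (bool * bool) * (bool * bool)) `|f a - g a|.

Definition W_free (f : (bool * bool) * (bool * bool) -> R) : Prop :=
  exists l : seq (R * Mat),
    [/\ (forall x, x \in l -> 0 <= x.1 /\ stab_state x.2),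
        \sum_(x <- l) x.1 = 1
      & forall a, f a = \sum_(x <- l) x.1 * wigner x.2 a].

(* Wigner distance C(rho) (a minimum, expressed as the infimum) *)
Definition wigner_distance (rho : Mat) : R :=
  inf ([set d : R | exists f, W_free f /\ d = l1dist (wigner rho) f])%classic.

Definition stab_extent (rho : Mat) : R :=
  inf ([set t : R | exists l : seq (R * Mat),
        [/\ (forall x, x \in l -> stab_state x.2),
            rho = \sum_(x <- l) rC x.1 *: x.2
          & t = \sum_(x <- l) `|x.1|]])%classic.

Definition tightness (rho : Mat) : R :=
  (stab_extent rho - 1) / wigner_distance rho.

Definition ket00 : 'cV[C]_(2 * 2) := \col_(i < 2 * 2) (if (i : nat) == 0%N then 1 else 0).
Definition ket11 : 'cV[C]_(2 * 2) := \col_(i < 2 * 2) (if (i : nat) == 3%N then 1 else 0).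

Definition psiRy (theta : R) : 'cV[C]_(2 * 2) :=
  rC (cos (theta / 2)) *: ket00 + rC (sin (theta / 2)) *: ket11.
Definition psiRx (theta : R) : 'cV[C]_(2 * 2) :=
  rC (cos (theta / 2)) *: ket00 - (iC * rC (sin (theta / 2))) *: ket11.

Definition rhoRy (theta : R) : Mat := psiRy theta *m dagger (psiRy theta).
Definition rhoRx (theta : R) : Mat := psiRx theta *m dagger (psiRx theta).

End Defs.

(* Main.v *)
Require Import Defs.
From HB Require Import structures.
From mathcomp Require Import all_boot all_order all_algebra.
From mathcomp Require Import boolp classical_sets reals trigo.
From mathcomp Require Import ring lra.
From mathcomp Require complex mxtens.
Import complex.
Set Implicit Arguments.
Unset Strict Implicit.
Unset Printing Implicit Defensive.
Import Order.TTheory GRing.Theory Num.Theory.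
Local Open Scope ring_scope.

(** Both families live in the code space spanned by |00> and |11>, the +1
    eigenspace of ZZ, on which ZI, XX and XY act as logical Pauli operators. The
    states have logical Bloch vectors (z, x, y) = (cos, sin, 0) and
    (cos, 0, - sin), and the stabilizer states of the code are the vertices of
    the octahedron |z| + |x| + |y| <= 1. On the code the l1 distance of Wigner
    functions is |dx| + max(|dz|, |dy|), so that it does not treat x and y alike:
    this is where the factor 2 comes from. Decomposing over the vertices of the
    octahedron, or moving to one of its points, gives the upper bounds.

    The lower bounds are linear programming duals. Of two anticommuting Paulis,
    one has expectation 0 in a given stabilizer state, so a combination of
    pairwise anticommuting Paulis with coefficients in [-1, 1] has expectation in
    [-1, 1] on every stabilizer state. For the extent the dual witness is
    +-ZI +- XX +- XY; for the distance it is such a combination symmetrized under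
    multiplication by ZZ, whose Wigner function is small enough. *)

Local Notation "A *t B" := (mxtens.tensmx A B) (at level 40, left associativity).

(** * Preliminaries *)

Lemma sum_pair (V : nmodType) (I J : finType) (F : I * J -> V) :
  \sum_a F a = \sum_i \sum_j F (i, j).
Proof. by rewrite pair_bigA; apply: eq_bigr => -[]. Qed.

Lemma normrD_normrB (R : realFieldType) (x y : R) :
  `|x + y| + `|x - y| = 2 * Num.max `|x| `|y|.
Proof.
by case: (leP `|x| `|y|); case: (ger0P x); case: (ger0P y);
  case: (ger0P (x + y)); case: (ger0P (x - y)); lra.
Qed.

Lemma normr_half_add_sub (R : realFieldType) (x y : R) :
  `|x| <= `|y| -> `|(x + y) / 2| + `|(x - y) / 2| = `|y|.
Proof.
move=> x_le; rewrite !normf_div normr_nat -mulrDl normrD_normrB (max_idPr x_le).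
by field.
Qed.

Lemma inf_minimum (R : realType) (E : set R) m : E m -> lbound E m -> inf E = m.
Proof.
move=> Em mE; apply/le_anti/andP; split; first by apply: ge_inf => //; exists m.
by apply: lb_le_inf => //; exists m.
Qed.

Lemma cos_half (R : realType) (t : R) : cos t = cos (t / 2) ^+ 2 - sin (t / 2) ^+ 2.
Proof.
have {1}-> : t = (t / 2) *+ 2 by rewrite -mulr_natr divfK // pnatr_eq0.
by rewrite cos_mulr2n; have := cos2Dsin2 (t / 2); lra.
Qed.

Lemma sin_half (R : realType) (t : R) : sin t = 2 * (cos (t / 2) * sin (t / 2)).
Proof.
have {1}-> : t = (t / 2) *+ 2 by rewrite -mulr_natr divfK // pnatr_eq0.
by rewrite sin_mulr2n mulr2n; ring.
Qed.

Lemma norm_cos_sin_ge1 (R : realType) (t : R) : 1 <= `|cos t| + `|sin t|.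
Proof.
rewrite -(cos2Dsin2 t) -real_normK ?num_real // -[sin t ^+ 2]real_normK ?num_real //.
by rewrite lerD // expr2 ler_piMl // ?cos_max ?sin_max.
Qed.

Lemma ord2P (P : 'I_2 -> Prop) : P 0 -> P 1 -> forall i, P i.
Proof.
by move=> P0 P1 [[|[|//]] h]; [move: P0|move: P1]; congr P; apply/val_inj.
Qed.

Lemma mulmx_cV11 (R : comPzRingType) n (v : 'cV[R]_n) (A : 'M_1) :
  v *m A = A 0 0 *: v.
Proof. by rewrite [A in LHS]mx11_scalar mul_mx_scalar. Qed.

Section TensorProduct.
Variable R : comPzRingType.

Lemma tensmx1 m n : (1%:M : 'M[R]_m) *t (1%:M : 'M_n) = 1%:M.
Proof.
apply/matrixP => i j.
case: (mxtens.mxtens_indexP i) => i0 i1; case: (mxtens.mxtens_indexP j) => j0 j1.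
rewrite mxtens.tensmxE !mxE (can_eq (@mxtens.mxtens_indexK m n)) xpair_eqE.
by rewrite -natrM mulnb.
Qed.

Lemma tensmxZ m n p q (a b : R) (A : 'M_(m, n)) (B : 'M_(p, q)) :
  (a *: A) *t (b *: B) = (a * b) *: (A *t B).
Proof. by apply/matrixP => i j; rewrite !mxE mulrACA. Qed.

Lemma tensmx_sum (I J : finType) m n p q (F : I -> 'M[R]_(m, n)) (G : J -> 'M_(p, q)) :
  (\sum_i F i) *t (\sum_j G j) = \sum_a F a.1 *t G a.2.
Proof.
apply/matrixP => i j; rewrite mxE !summxE big_distrlr /= pair_bigA.
by apply: eq_bigr => a _; rewrite mxE.
Qed.

Lemma mxtrace_tens m n (A : 'M[R]_m) (B : 'M_n) : \tr (A *t B) = \tr A * \tr B.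
Proof. by rewrite /mxtrace mxtens.mulr_sum; apply: eq_bigr => i _; rewrite mxE. Qed.

End TensorProduct.

Section ComplexMatrices.
Variable R : realType.
Local Notation C := (complex.complex R).

Lemma complexP (x y : C) :
  complex.Re x = complex.Re y -> complex.Im x = complex.Im y -> x = y.
Proof. by case: x y => [? ?] [? ?] /= -> ->. Qed.

HB.instance Definition _ :=
  GRing.RMorphism.copy (@rC R) (@complex.real_complex_def R (Phant R)).

Lemma sqr_iC : iC R ^+ 2 = -1.
Proof. by apply: complexP => /=; ring. Qed.

Lemma cube_iC : iC R ^+ 3 = - iC R.
Proof. by rewrite exprS sqr_iC mulrN1. Qed.

Lemma conjc_iCX k : complex.conjc (iC R ^+ k) * iC R ^+ k = 1.
Proof.
rewrite rmorphXn /= -exprMn (_ : _ * _ = 1) ?expr1n //.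
by apply: complexP => /=; ring.
Qed.

Lemma daggerM m n k (A : 'M[C]_(m, n)) (B : 'M[C]_(n, k)) :
  dagger (A *m B) = dagger B *m dagger A.
Proof. by rewrite /dagger trmx_mul map_mxM. Qed.

Lemma daggerZ m n (c : C) (A : 'M[C]_(m, n)) :
  dagger (c *: A) = complex.conjc c *: dagger A.
Proof. by rewrite /dagger linearZ /= map_mxZ. Qed.

Lemma daggerK m n (A : 'M[C]_(m, n)) : dagger (dagger A) = A.
Proof. by apply/matrixP => i j; rewrite !mxE complex.conjcK. Qed.

Lemma unit_vector_neq0 n (psi : 'cV[C]_n) : dagger psi *m psi = 1%:M -> psi != 0.
Proof.
move=> psi1; apply/eqP => psi0; move: psi1; rewrite psi0 mulmx0 => /matrixP/(_ 0 0).
by rewrite !mxE /= => /esym/eqP; rewrite oner_eq0.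
Qed.

Definition expect n (A B : 'M[C]_n) : R := complex.Re (\tr (A *m B)).

Lemma expectC n (A B : 'M[C]_n) : expect A B = expect B A.
Proof. by rewrite /expect mxtrace_mulC. Qed.

Lemma expect_is_zmod_morphism n (A : 'M[C]_n) : zmod_morphism (expect A).
Proof.
move=> B D; rewrite /expect mulmxBr [\tr _]linearB /=.
by case: (\tr (A *m B)) (\tr (A *m D)) => [? ?] [? ?].
Qed.

HB.instance Definition _ n (A : 'M[C]_n) :=
  GRing.isZmodMorphism.Build 'M[C]_n R (expect A) (expect_is_zmod_morphism A).

Lemma expectZ n (A B : 'M[C]_n) (x : R) : expect A (rC x *: B) = x * expect A B.
Proof.
rewrite /expect -scalemxAr mxtraceZ.
by case: (\tr _) => a b /=; rewrite mul0r subr0.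
Qed.

Lemma expect_anticomm n (rho g M : 'M[C]_n) :
  g *m rho = rho -> rho *m g = rho -> M *m g = - (g *m M) -> expect rho M = 0.
Proof.
move=> grho rhog Mg; have : expect rho M = - expect rho M.
  rewrite -{1}grho /expect -mulmxA mxtrace_mulC -mulmxA Mg mulmxN mulmxA rhog.
  by rewrite -mulmxN -[LHS]/(expect rho (- M)) raddfN.
lra.
Qed.

Lemma expect_pure_eigen n (psi : 'cV[C]_n) (M : 'M[C]_n) (x : R) :
  dagger psi *m psi = 1%:M -> M *m psi = rC x *: psi ->
  expect (psi *m dagger psi) M = x.
Proof.
move=> psi1 Mpsi; rewrite expectC /expect mulmxA Mpsi -scalemxAl mxtraceZ.
by rewrite mxtrace_mulC psi1 mxtrace1 mulr1.
Qed.

End ComplexMatrices.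

(** * Pauli operators *)

Section PauliOperators.
Variable R : realType.
Local Notation C := (complex.complex R).
Local Notation Mat := (matrix C (2 * 2) (2 * 2)).

Definition pauli_anticomm (p q : pauli) : bool :=
  match p, q with
  | PI, _ | _, PI | PX, PX | PY, PY | PZ, PZ => false
  | _, _ => true
  end.

(* [(k, r)] stands for [iC ^+ k *: r]. *)
Definition pauli_mul (p q : pauli) : nat * pauli :=
  match p, q with
  | PI, r | r, PI => (0%N, r)
  | PX, PX | PY, PY | PZ, PZ => (0%N, PI)
  | PX, PY => (1%N, PZ) | PY, PZ => (1%N, PX) | PZ, PX => (1%N, PY)
  | PY, PX => (3%N, PZ) | PZ, PY => (3%N, PX) | PX, PZ => (3%N, PY)
  end.

Ltac pauli_entries :=
  apply/matrixP; do 2 apply: ord2P;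
  rewrite !mxE ?big_ord_recl ?big_ord0 ?mxE /=; apply: complexP => /=.

Lemma dagger_pauli_mx p : dagger (pauli_mx R p) = pauli_mx R p.
Proof. by case: p; pauli_entries; ring. Qed.

Lemma pauli_mxM p q : pauli_mx R p *m pauli_mx R q =
  iC R ^+ (pauli_mul p q).1 *: pauli_mx R (pauli_mul p q).2.
Proof.
by case: p; case: q; rewrite /= ?expr0 ?expr1 ?cube_iC; pauli_entries; ring.
Qed.

Lemma pauli_mx_comm p q : pauli_mx R p *m pauli_mx R q =
  (-1) ^+ pauli_anticomm p q *: (pauli_mx R q *m pauli_mx R p).
Proof.
by case: p; case: q; rewrite !pauli_mxM /= ?cube_iC ?expr1 ?expr0 ?scaleN1r ?scale1r
  ?scaleNr ?opprK.
Qed.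

Lemma mxtrace_pauli_mx p : \tr (pauli_mx R p) = if p is PI then 2 else 0.
Proof.
by case: p; rewrite /mxtrace !big_ord_recl big_ord0 !mxE /=;
  apply: complexP => /=; ring.
Qed.

Definition pauli2 (P : pauli * pauli) : Mat := pauli_mx R P.1 *t pauli_mx R P.2.

Definition pauli2_anticomm (P Q : pauli * pauli) : bool :=
  pauli_anticomm P.1 Q.1 (+) pauli_anticomm P.2 Q.2.

Lemma pauli2_id : pauli2 (PI, PI) = 1%:M.
Proof. exact: tensmx1. Qed.

Lemma dagger_pauli2 P : dagger (pauli2 P) = pauli2 P.
Proof.
rewrite /dagger /pauli2 mxtens.trmx_tens mxtens.map_mxT.
by congr (_ *t _); apply: dagger_pauli_mx.
Qed.

Lemma pauli2M P Q : pauli2 P *m pauli2 Q =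
  iC R ^+ ((pauli_mul P.1 Q.1).1 + (pauli_mul P.2 Q.2).1)
    *: pauli2 ((pauli_mul P.1 Q.1).2, (pauli_mul P.2 Q.2).2).
Proof. by rewrite /pauli2 mxtens.tensmx_mul !pauli_mxM tensmxZ exprD. Qed.

Lemma pauli2_sqr P : pauli2 P *m pauli2 P = 1%:M.
Proof. by case: P => -[] []; rewrite pauli2M scale1r pauli2_id. Qed.

Lemma pauli2_comm P Q :
  pauli2 P *m pauli2 Q = (-1) ^+ pauli2_anticomm P Q *: (pauli2 Q *m pauli2 P).
Proof.
rewrite /pauli2 !mxtens.tensmx_mul pauli_mx_comm (pauli_mx_comm P.2).
by rewrite tensmxZ signr_addb.
Qed.

Lemma mxtrace_pauli2 P : \tr (pauli2 P) = if P is (PI, PI) then 4 else 0.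
Proof.
rewrite mxtrace_tens !mxtrace_pauli_mx; case: P => -[] [] /=; ring.
Qed.

Lemma pauli_group2P (g : Mat) :
  pauli_group2 g <-> exists k P, g = iC R ^+ k *: pauli2 P.
Proof.
by split=> [[k [p [q ->]]]|[k [[p q] ->]]]; [exists k, (p, q)|exists k, p, q].
Qed.

Lemma pauli_group2_pauli2 (b : bool) P : pauli_group2 ((-1) ^+ b *: pauli2 P).
Proof. by apply/pauli_group2P; exists (2 * b)%N, P; rewrite exprM sqr_iC. Qed.

Lemma pauli_group2M (g h : Mat) :
  pauli_group2 g -> pauli_group2 h -> pauli_group2 (g *m h).
Proof.
move=> /pauli_group2P[k [P ->]] /pauli_group2P[l [Q ->]]; apply/pauli_group2P.
rewrite -scalemxAl -scalemxAr pauli2M !scalerA -!exprD.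
by do 2 eexists.
Qed.

Lemma pauli_group2_unitary (g : Mat) : pauli_group2 g -> dagger g *m g = 1%:M.
Proof.
move=> /pauli_group2P[k [P ->]]; rewrite daggerZ dagger_pauli2.
by rewrite -scalemxAl -scalemxAr pauli2_sqr scalerA conjc_iCX scale1r.
Qed.

Lemma pauli_group2_comm_or_anticomm (g : Mat) P : pauli_group2 g ->
  pauli2 P *m g = g *m pauli2 P \/ pauli2 P *m g = - (g *m pauli2 P).
Proof.
move=> /pauli_group2P[k [Q ->]]; rewrite -scalemxAl -scalemxAr (pauli2_comm P).
by case: (pauli2_anticomm _ _); [right|left];
  rewrite ?expr1 ?scaleN1r ?scalerN ?expr0 ?scale1r.
Qed.

Definition pauli_comb (s : seq (R * (pauli * pauli))) : Mat :=
  \sum_(x <- s) rC x.1 *: pauli2 x.2.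

Lemma expect_pauli_comb (rho : Mat) s :
  expect rho (pauli_comb s) = \sum_(x <- s) x.1 * expect rho (pauli2 x.2).
Proof. by rewrite raddf_sum; apply: eq_bigr => x _ /=; rewrite expectZ. Qed.

Lemma expect_pauli_comb2 s t : expect (pauli_comb s) (pauli_comb t) =
  \sum_(x <- s) x.1 * \sum_(y <- t) y.1 * expect (pauli2 x.2) (pauli2 y.2).
Proof.
rewrite expectC expect_pauli_comb; apply: eq_bigr => x _.
by rewrite expectC expect_pauli_comb.
Qed.

Lemma expect_pauli2 P Q : expect (pauli2 P) (pauli2 Q) =
  if ((pauli_mul P.1 Q.1).2, (pauli_mul P.2 Q.2).2) is (PI, PI) then 4 else 0.
Proof.
rewrite /expect pauli2M mxtraceZ mxtrace_pauli2.
by case: P Q => -[] [] [[] []]; rewrite /= ?mulr0 /=; ring.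
Qed.

End PauliOperators.

(** * Stabilizer states *)

Section StabilizerExpectations.
Variable R : realType.
Local Notation C := (complex.complex R).
Local Notation Mat := (matrix C (2 * 2) (2 * 2)).

Lemma expect_stabilized_anticomm (psi : 'cV[C]_(2 * 2)) (g M : Mat) :
  pauli_group2 g -> g *m psi = psi -> M *m g = - (g *m M) ->
  expect (psi *m dagger psi) M = 0.
Proof.
move=> Pg gpsi; apply: expect_anticomm; first by rewrite mulmxA gpsi.
rewrite -mulmxA; congr (_ *m _); apply: (can_inj (@daggerK R _ _)).
by rewrite daggerM daggerK -{1}gpsi mulmxA pauli_group2_unitary ?mul1mx.
Qed.

(* If P commutes with the stabilizer group, then P psi is stabilized, hence
   proportional to psi by uniqueness; otherwise P anticommutes with a stabilizer. *)
Lemma stab_state_pauli2 (sigma : Mat) : stab_state sigma ->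
  exists psi : 'cV[C]_(2 * 2),
    [/\ dagger psi *m psi = 1%:M, sigma = psi *m dagger psi &
      forall P, expect sigma (pauli2 R P) = 0 \/
        exists b : bool, pauli2 R P *m psi = rC ((-1) ^+ b) *: psi].
Proof.
move=> [S [psi [[[_ _ Sp _ _] _] psi1 Spsi uniq_psi ->]]]; exists psi; split=> // P.
have [comm|] := pselect (forall g, g \in S -> pauli2 R P *m g = g *m pauli2 R P).
  right; have [g Sg|c Ppsi] := uniq_psi (pauli2 R P *m psi).
    by rewrite mulmxA -comm // -mulmxA Spsi.
  have /eqP : (c ^+ 2 - 1) *: psi = 0.
    apply/eqP; rewrite scalerBl scale1r subr_eq0 expr2 -scalerA -Ppsi scalemxAr -Ppsi.
    by rewrite mulmxA pauli2_sqr mul1mx.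
  rewrite scaler_eq0 (negbTE (unit_vector_neq0 psi1)) orbF subr_eq0 sqrf_eq1 Ppsi.
  by case/orP=> /eqP ->; [exists false|exists true]; rewrite rmorph_sign.
move=> /existsNP[g /not_implyP[Sg Pg_neq_gP]]; left.
apply: (expect_stabilized_anticomm (Sp g Sg) (Spsi g Sg)).
by have [] := pauli_group2_comm_or_anticomm P (Sp g Sg).
Qed.

Lemma stab_state_expect_le1 (sigma : Mat) P :
  stab_state sigma -> `|expect sigma (pauli2 R P)| <= 1.
Proof.
move=> /stab_state_pauli2[psi [psi1 -> /(_ P) [->|[b /(expect_pure_eigen psi1) ->]]]].
  by rewrite normr0 ler01.
by rewrite normr_sign.
Qed.

Lemma stab_state_expect_anticomm (sigma : Mat) P Q :
  stab_state sigma -> pauli2_anticomm P Q ->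
  expect sigma (pauli2 R P) = 0 \/ expect sigma (pauli2 R Q) = 0.
Proof.
move=> /stab_state_pauli2[psi [_ -> /(_ P) [->|[b Ppsi]]]] PQ; [by left|right].
apply: (expect_stabilized_anticomm (pauli_group2_pauli2 R b P)).
  by rewrite -scalemxAl Ppsi scalerA rmorph_sign -expr2 sqrr_sign scale1r.
by rewrite -scalemxAl -scalemxAr pauli2_comm PQ expr1 scaleN1r scalerN opprK.
Qed.

Lemma stab_state_expect_anticomm_comb (sigma : Mat) (k : R)
    (s : seq (R * (pauli * pauli))) :
  0 <= k -> stab_state sigma -> all (fun x => `|x.1| <= k) s ->
  pairwise (fun x y => pauli2_anticomm x.2 y.2) s ->
  `|expect sigma (pauli_comb s)| <= k.
Proof.
move=> k_ge0 st; rewrite expect_pauli_comb.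
elim: s => [|x s IHs] /=; first by rewrite big_nil normr0.
rewrite big_cons => /andP[x_le_k s_le_k] /andP[anti_x anti_s].
have [->|Px_neq0] := eqVneq (expect sigma (pauli2 R x.2)) 0.
  by rewrite mulr0 add0r; apply: IHs.
suff -> : \sum_(y <- s) y.1 * expect sigma (pauli2 R y.2) = 0.
  by rewrite addr0 normrM -[k]mulr1 ler_pM // stab_state_expect_le1.
elim: s anti_x {s_le_k anti_s IHs} => [|y s IHs_x] /=; first by rewrite big_nil.
case/andP=> xy /IHs_x sum0; rewrite big_cons sum0 addr0.
have [/eqP|->] := stab_state_expect_anticomm st xy; last by rewrite mulr0.
by rewrite (negbTE Px_neq0).
Qed.

End StabilizerExpectations.

Section TwoGenerators.
Variable R : realType.
Local Notation C := (complex.complex R).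
Local Notation Mat := (matrix C (2 * 2) (2 * 2)).
Variables g h : Mat.
Hypotheses (Pg : pauli_group2 g) (Ph : pauli_group2 h).
Hypotheses (g_sqr : g *m g = 1%:M) (h_sqr : h *m h = 1%:M) (gh : g *m h = h *m g).
Hypotheses (tr_g : \tr g = 0) (tr_h : \tr h = 0) (tr_gh : \tr (g *m h) = 0).

Let S : seq Mat := [:: 1%:M; g; h; g *m h].

Let in_S x : x \in S -> [\/ x = 1%:M, x = g, x = h | x = g *m h].
Proof.
by rewrite !inE => /or4P[] /eqP ->; [apply: Or41|apply: Or42|apply: Or43|apply: Or44].
Qed.

Let gK n : cancel (mulmx g : 'M_(2 * 2, n) -> _) (mulmx g).
Proof. by move=> A; rewrite mulmxA g_sqr mul1mx. Qed.

Let hK n : cancel (mulmx h : 'M_(2 * 2, n) -> _) (mulmx h).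
Proof. by move=> A; rewrite mulmxA h_sqr mul1mx. Qed.

Let ghA (A : Mat) : h *m (g *m A) = g *m (h *m A).
Proof. by rewrite mulmxA -gh mulmxA. Qed.

Let S_uniq : uniq S.
Proof.
have tr_neq1 (A : Mat) : \tr A = 0 -> A != 1%:M.
  by move=> tr_A; apply/eqP => A1; move/eqP: tr_A; rewrite A1 mxtrace1 pnatr_eq0.
rewrite /= !inE !negb_or !andbT -!(eq_sym _ 1%:M) !tr_neq1 //=.
rewrite -{1}(can_eq (@gK _)) g_sqr eq_sym tr_neq1 //=.
rewrite -{1}(can_eq (@gK _)) g_sqr gK eq_sym tr_neq1 //=.
by rewrite -(can_eq (@hK _)) h_sqr gh hK eq_sym tr_neq1.
Qed.

Lemma stabilizer_group_two_generators : stabilizer_group S.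
Proof.
have P1 : pauli_group2 (1%:M : Mat) by rewrite -g_sqr; apply: pauli_group2M.
split; split=> //.
- by move=> x /in_S[] -> //; apply: pauli_group2M.
- by rewrite inE eqxx.
- by move=> x y /in_S[] -> /in_S[] ->; rewrite ?mul1mx ?mulmx1 -?mulmxA -?gh
    ?ghA ?h_sqr ?g_sqr ?gK ?hK ?mulmx1 ?h_sqr !inE eqxx ?orbT.
- move=> x Sx; exists x => //; move: Sx => /in_S[] ->; rewrite ?mulmx1 //.
  by rewrite -mulmxA ghA gK h_sqr.
- by move=> x y /in_S[] -> /in_S[] ->; rewrite ?mul1mx ?mulmx1 -?mulmxA -?gh
    ?ghA ?h_sqr ?g_sqr ?gK ?hK.
- have trN1 : \tr (- 1%:M : Mat) = - 4 by rewrite linearN /= mxtrace1.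
  apply/negP => /in_S N1_eq; have : \tr (- 1%:M : Mat) = 4 \/ \tr (- 1%:M : Mat) = 0.
    by case: N1_eq => ->; rewrite ?mxtrace1; auto.
  by rewrite trN1 => -[] /(congr1 (@complex.Re R)) /=; lra.
Qed.

Lemma stab_state_two_generators (psi : 'cV[C]_(2 * 2)) :
  psi *m dagger psi = rC 4^-1 *: ((1%:M + g) *m (1%:M + h)) ->
  stab_state (psi *m dagger psi).
Proof.
move=> psi_proj; have rC4 : rC 4^-1 * 4 = 1 :> C.
  by rewrite fmorphV rmorph_nat mulVf // pnatr_eq0.
have psi1 : dagger psi *m psi = 1%:M.
  have tr_psi : \tr (psi *m dagger psi) = 1.
    rewrite psi_proj mxtraceZ mulmxDl mul1mx mulmxDr mulmx1 !mxtraceD.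
    by rewrite tr_g tr_h tr_gh mxtrace1 !addr0.
  rewrite [LHS]mx11_scalar; congr _%:M.
  by rewrite -tr_psi mxtrace_mulC /mxtrace big_ord1.
have fix_psi A : A *m (psi *m dagger psi) = psi *m dagger psi -> A *m psi = psi.
  by move=> /(congr1 (mulmx^~ psi)); rewrite -!mulmxA psi1 !mulmx1.
have gpsi : g *m psi = psi.
  apply: fix_psi; rewrite psi_proj -scalemxAr mulmxA; congr (_ *: (_ *m _)).
  by rewrite mulmxDr mulmx1 g_sqr addrC.
have hpsi : h *m psi = psi.
  apply: fix_psi; rewrite psi_proj -scalemxAr; congr (_ *: _).
  rewrite mulmxDl mul1mx !mulmxDr !mulmx1 ghA h_sqr mulmx1 -gh.
  by rewrite (addrC h) (addrC (g *m h)).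
exists S, psi; split=> //; first exact: stabilizer_group_two_generators.
- by move=> x /in_S[] ->; rewrite ?mul1mx // -mulmxA hpsi.
- move=> phi S_phi; exists ((dagger psi *m phi) 0 0).
  rewrite -mulmx_cV11 mulmxA psi_proj.
  have [gphi hphi] : g *m phi = phi /\ h *m phi = phi.
    by split; apply: S_phi; rewrite !inE eqxx ?orbT.
  rewrite -scalemxAl -mulmxA (mulmxDl 1%:M h) hphi mul1mx mulmxDr !mulmxDl mul1mx gphi.
  by rewrite -!mulr2n -mulrnA -scaler_nat scalerA rC4 scale1r.
Qed.

End TwoGenerators.

(** * Wigner functions *)

Section WignerFunction.
Variable R : realType.
Local Notation C := (complex.complex R).
Local Notation Mat := (matrix C (2 * 2) (2 * 2)).

Definition pauli_sign (p : pauli) (a : bool * bool) : R :=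
  (-1) ^+ match p with PI => false | PX => a.2 | PY => a.1 (+) a.2 | PZ => a.1 end.

Definition pauli2_sign (P : pauli * pauli) (a : (bool * bool) * (bool * bool)) : R :=
  pauli_sign P.1 a.1 * pauli_sign P.2 a.2.

Lemma pauli_sign_orthogonal p q : \sum_a pauli_sign p a * pauli_sign q a =
  if (pauli_mul p q).2 is PI then 4 else 0.
Proof.
rewrite (@sum_pair R) !big_bool /pauli_sign.
by case: p; case: q => /=; rewrite ?expr0 ?expr1; ring.
Qed.

Lemma A1E a :
  A1 R a = \sum_(p <- [:: PI; PX; PY; PZ]) rC (2^-1 * pauli_sign p a) *: pauli_mx R p.
Proof.
under eq_bigr => p _ do rewrite rmorphM -scalerA; rewrite -scaler_sumr.
rewrite !big_cons big_nil addr0 !addrA /pauli_sign !(rmorph_sign (@rC R)).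
by case: a => -[] []; rewrite /= ?expr0 ?expr1 ?scale1r.
Qed.

Lemma mxtrace_pauli_A1 p a : \tr (pauli_mx R p *m A1 R a) = rC (pauli_sign p a).
Proof.
rewrite A1E mulmx_sumr raddf_sum.
under eq_bigr => q _ do
  rewrite /= -scalemxAr mxtraceZ pauli_mxM mxtraceZ mxtrace_pauli_mx.
rewrite !big_cons big_nil.
by case: p => /=; rewrite ?mulr0 ?add0r ?addr0; field.
Qed.

Lemma sum_pauli_sign_A1 p : \sum_a rC (pauli_sign p a) *: A1 R a = rC 2 *: pauli_mx R p.
Proof.
under eq_bigr => a _ do rewrite A1E scaler_sumr.
rewrite exchange_big /=.
under eq_bigr => q _.
  under eq_bigr => a _ do rewrite scalerA -rmorphM mulrCA.
  rewrite -scaler_suml -rmorph_sum -mulr_sumr pauli_sign_orthogonal.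
  over.
have half4 : 2^-1 * 4 = 2 :> R by field.
rewrite !big_cons big_nil.
by case: p => /=; rewrite mulr0 rmorph0 half4 !scale0r ?add0r ?addr0.
Qed.

Lemma wigner_pauli2 P a : wigner (pauli2 R P) a = pauli2_sign P a / 4.
Proof.
rewrite /wigner mxtens.tensmx_mul mxtrace_tens !mxtrace_pauli_A1.
by rewrite /= mulr0 subr0.
Qed.

Lemma pauli2_phase_pointE P :
  pauli2 R P = \sum_a rC (wigner (pauli2 R P) a) *: phase_point R a.
Proof.
rewrite [RHS](_ : _ = rC 4^-1 *: \sum_a
    (rC (pauli_sign P.1 a.1) *: A1 R a.1) *t (rC (pauli_sign P.2 a.2) *: A1 R a.2)).
  rewrite -(tensmx_sum (fun a => rC (pauli_sign P.1 a) *: A1 R a)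
    (fun a => rC (pauli_sign P.2 a) *: A1 R a)) !sum_pauli_sign_A1 tensmxZ scalerA.
  have quarter4 : 4^-1 * (2 * 2) = 1 :> R by field.
  by rewrite -!(rmorphM (@rC R)) quarter4 rmorph1 scale1r.
rewrite scaler_sumr; apply: eq_bigr => a _.
by rewrite tensmxZ scalerA -!rmorphM wigner_pauli2 mulrC.
Qed.

Lemma wignerE (rho : Mat) a : wigner rho a = expect (phase_point R a) rho / 4.
Proof. by rewrite expectC. Qed.

Lemma wigner_pauli_comb s a :
  wigner (pauli_comb s) a = \sum_(x <- s) x.1 * pauli2_sign x.2 a / 4.
Proof.
rewrite wignerE expect_pauli_comb mulr_suml; apply: eq_bigr => x _.
by rewrite -mulrA -wignerE wigner_pauli2 mulrA.
Qed.

Lemma pauli_comb_phase_pointE s :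
  pauli_comb s = \sum_a rC (wigner (pauli_comb s) a) *: phase_point R a.
Proof.
rewrite {1}/pauli_comb; under eq_bigr do rewrite pauli2_phase_pointE scaler_sumr.
rewrite exchange_big; apply: eq_bigr => a _.
rewrite wigner_pauli_comb rmorph_sum scaler_suml; apply: eq_bigr => x _.
by rewrite scalerA -rmorphM wigner_pauli2 mulrA.
Qed.

Lemma wigner_traciality (rho : Mat) s :
  expect rho (pauli_comb s) = 4 * \sum_a wigner (pauli_comb s) a * wigner rho a.
Proof.
rewrite {1}pauli_comb_phase_pointE raddf_sum mulr_sumr; apply: eq_bigr => a _ /=.
by rewrite expectZ (wignerE rho) expectC; field.
Qed.

Lemma W_free_l1dist_ge (rho : Mat) s (k : R) f :
  (forall a, `|wigner (pauli_comb s) a| <= 4^-1) ->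
  (forall sigma, stab_state sigma -> expect sigma (pauli_comb s) <= k) ->
  W_free f -> expect rho (pauli_comb s) - k <= l1dist (wigner rho) f.
Proof.
move=> w_le stab_le [l [lP l_sum fE]].
have f_le : 4 * \sum_a wigner (pauli_comb s) a * f a <= k.
  have -> : k = \sum_(x <- l) x.1 * k by rewrite -mulr_suml l_sum mul1r.
  under eq_bigr => a _ do rewrite fE mulr_sumr.
  rewrite exchange_big mulr_sumr /= !big_seq; apply: ler_sum => x /lP[x0 /stab_le].
  rewrite wigner_traciality => /(ler_wpM2l x0); apply: le_trans.
  under eq_bigr => a _ do rewrite mulrCA.
  by rewrite -mulr_sumr mulrCA.
apply: le_trans (lerB (lexx _) f_le) _.
rewrite wigner_traciality -mulrBr -sumrB mulr_sumr.
apply: ler_sum => a _; rewrite -mulrBr mulrA (le_trans (ler_norm _)) // normrM.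
by rewrite ler_piMl // normrM ger0_norm // mulrC -ler_pdivlMr // mul1r.
Qed.

Lemma stab_decomposition_l1_ge (rho M : Mat) (l : seq (R * Mat)) :
  (forall sigma, stab_state sigma -> `|expect sigma M| <= 1) ->
  (forall x, x \in l -> stab_state x.2) -> rho = \sum_(x <- l) rC x.1 *: x.2 ->
  expect rho M <= \sum_(x <- l) `|x.1|.
Proof.
move=> M_le1 lP ->; rewrite expectC raddf_sum !big_seq; apply: ler_sum => x /lP st /=.
rewrite expectZ (le_trans (ler_norm _)) // normrM ler_piMr //.
by rewrite expectC M_le1.
Qed.

End WignerFunction.

(** * The code space *)

Section CodeSpace.
Variable R : realType.
Local Notation C := (complex.complex R).
Local Notation Mat := (matrix C (2 * 2) (2 * 2)).
Local Notation ZZ := (pauli2 R (PZ, PZ)).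

Definition logical (z x y : R) : seq (R * (pauli * pauli)) :=
  [:: (z, (PZ, PI)); (x, (PX, PX)); (y, (PX, PY))].

Definition logicalZZ (z x y : R) : seq (R * (pauli * pauli)) :=
  [:: (z, (PI, PZ)); (- x, (PY, PY)); (y, (PY, PX))].

Lemma logicalM_ZZ z x y :
  pauli_comb (logical z x y) *m ZZ = pauli_comb (logicalZZ z x y).
Proof.
have i6 : iC R ^+ (3 + 3) = -1.
  by rewrite -[(3 + 3)%N]/(2 * 3)%N exprM sqr_iC -signr_odd expr1.
have i4 : iC R ^+ (3 + 1) = 1.
  by rewrite -[(3 + 1)%N]/(2 * 2)%N exprM sqr_iC -signr_odd.
rewrite /pauli_comb mulmx_suml.
under eq_bigr => t _ do rewrite -scalemxAl pauli2M.
rewrite !big_cons !big_nil /= i6 i4 expr0 scaleN1r scalerN.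
by rewrite rmorphN scaleNr !scale1r.
Qed.

Definition code_terms (z x y : R) := logical z x y ++ logicalZZ z x y.

(* The projector (1 + ZZ) / 2 onto the code space times the density operator with
   Bloch vector (z, x, y) for the logical Pauli operators ZI, XX and XY. *)
Definition code_op (z x y : R) : Mat :=
  rC 4^-1 *: ((1%:M + pauli_comb (logical z x y)) *m (1%:M + ZZ)).

Lemma code_opE z x y : code_op z x y = rC 4^-1 *:
  pauli_comb ([:: (1, (PI, PI)); (1, (PZ, PZ))] ++ code_terms z x y).
Proof.
rewrite /code_op mulmxDl mul1mx mulmxDr mulmx1 logicalM_ZZ; congr (_ *: _).
rewrite /pauli_comb /code_terms !big_cat; congr (_ + _).
by rewrite !big_cons big_nil /= addr0 rmorph1 !scale1r pauli2_id.
Qed.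

Lemma expect_code_op z x y a b c :
  expect (code_op z x y) (pauli_comb (logical a b c)) = a * z + b * x + c * y /\
  expect (code_op z x y) (pauli_comb (logicalZZ a b c)) = a * z + b * x + c * y.
Proof.
split; rewrite code_opE expectC expectZ expect_pauli_comb2;
  under eq_bigr => u _ do under eq_bigr => v _ do rewrite expect_pauli2;
  by rewrite !big_cons !big_nil /= !(mulr0, addr0, add0r); field.
Qed.

Lemma wigner_code_opB z x y z' x' y' a :
  wigner (code_op z x y) a - wigner (code_op z' x' y') a =
  wigner (pauli_comb (code_terms (z - z') (x - x') (y - y'))) a / 4.
Proof.
rewrite !code_opE !wignerE !expectZ -![_ * expect _ _ / 4]mulrA -!wignerE.
by rewrite !wigner_pauli_comb !big_cons !big_nil /=; field.
Qed.

Lemma wigner_code_terms (z x y : R) a : wigner (pauli_comb (code_terms z x y)) a =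
  (if a.1.1 == a.2.1 then (-1) ^+ a.1.1 * (z + (-1) ^+ (a.1.2 (+) a.2.2) * y)
   else (-1) ^+ (a.1.2 (+) a.2.2) * x) / 2.
Proof.
rewrite wigner_pauli_comb !big_cons big_nil /pauli2_sign /pauli_sign.
by case: a => -[[] []] [[] []] /=; rewrite ?expr0 ?expr1; field.
Qed.

Lemma norm_wigner_code_terms (z x y : R) a :
  `|wigner (pauli_comb (code_terms z x y)) a| =
  (if a.1.1 == a.2.1 then `|z + (-1) ^+ (a.1.2 (+) a.2.2) * y| else `|x|) / 2.
Proof.
rewrite wigner_code_terms normf_div normr_nat.
by case: ifP => _; rewrite normrM normr_sign mul1r.
Qed.

Lemma l1dist_code_op z x y z' x' y' :
  l1dist (wigner (code_op z x y)) (wigner (code_op z' x' y')) =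
  `|x - x'| + Num.max `|z - z'| `|y - y'|.
Proof.
rewrite /l1dist.
under eq_bigr => a _ do
  rewrite wigner_code_opB normf_div normr_nat norm_wigner_code_terms.
have := normrD_normrB (z - z') (y - y').
rewrite (@sum_pair R) (@sum_pair R) !big_bool !(@sum_pair R) !big_bool /=.
by rewrite expr0 expr1 !mul1r !mulN1r; lra.
Qed.

Definition code_ket (u v : C) : 'cV[C]_(2 * 2) := u *: ket00 R + v *: ket11 R.

Lemma code_ketE u v i j : code_ket u v (mxtens.mxtens_index (i, j)) 0 =
  if i == j then (if i == 0 then u else v) else 0.
Proof.
by move: i j; do 2 apply: ord2P; rewrite !mxE /= ?mulr0 ?mulr1 ?addr0 ?add0r.
Qed.

(* The Bloch vector is the image of the amplitudes under the Hopf map. *)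
Lemma code_ket_pure (a b c d : R) : a ^+ 2 + b ^+ 2 + c ^+ 2 + d ^+ 2 = 1 ->
  let psi := code_ket (complex.Complex a b) (complex.Complex c d) in
  psi *m dagger psi = code_op (a ^+ 2 + b ^+ 2 - c ^+ 2 - d ^+ 2)
    (2 * (a * c + b * d)) (2 * (a * d - b * c)).
Proof.
move=> norm1 psi; rewrite code_opE; apply/matrixP => i j.
case: (mxtens.mxtens_indexP i) => i0 i1; case: (mxtens.mxtens_indexP j) => j0 j1.
rewrite [RHS]mxE summxE mxE big_ord1 [dagger _ _ _]mxE [X in complex.conjc X]mxE.
rewrite !code_ketE.
under [in RHS]eq_bigr => x _ do rewrite mxE mxtens.tensmxE.
rewrite !big_cons big_nil /=.
move: i0 i1 j0 j1; do 4 apply: ord2P; rewrite !mxE /=; apply: complexP => /=; lra.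
Qed.

End CodeSpace.

Section Octahedron.
Variable R : realType.
Local Notation C := (complex.complex R).
Local Notation Mat := (matrix C (2 * 2) (2 * 2)).
Local Notation ZZ := (pauli2 R (PZ, PZ)).

Lemma rhoRyE (t : R) : rhoRy t = code_op (cos t) (sin t) 0.
Proof.
have norm1 : cos (t / 2) ^+ 2 + 0 ^+ 2 + sin (t / 2) ^+ 2 + 0 ^+ 2 = 1.
  by rewrite expr0n !addr0 cos2Dsin2.
rewrite [LHS](code_ket_pure norm1) (cos_half t) (sin_half t).
by congr code_op; ring.
Qed.

Lemma rhoRxE (t : R) : rhoRx t = code_op (cos t) 0 (- sin t).
Proof.
have norm1 : cos (t / 2) ^+ 2 + 0 ^+ 2 + 0 ^+ 2 + (- sin (t / 2)) ^+ 2 = 1.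
  by rewrite expr0n !addr0 sqrrN cos2Dsin2.
have -> : rhoRx t = code_ket (rC (cos (t / 2))) (complex.Complex 0 (- sin (t / 2)))
    *m dagger (code_ket (rC (cos (t / 2))) (complex.Complex 0 (- sin (t / 2)))).
  rewrite /rhoRx /psiRx -scaleNr.
  by rewrite (_ : - (iC R * _) = complex.Complex 0 (- sin (t / 2))) //;
    apply: complexP => /=; ring.
rewrite (code_ket_pure norm1) (cos_half t) (sin_half t).
by congr code_op; ring.
Qed.

Lemma stab_state_code_op (b : bool) P (psi : 'cV[C]_(2 * 2)) z x y :
  psi *m dagger psi = code_op z x y ->
  pauli_comb (logical z x y) = (-1) ^+ b *: pauli2 R P ->
  ~~ pauli2_anticomm P (PZ, PZ) -> P <> (PI, PI) -> P <> (PZ, PZ) ->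
  stab_state (code_op z x y).
Proof.
move=> psi_code comb_P comm P_neqI P_neqZZ; rewrite -psi_code.
apply: (@stab_state_two_generators _ ((-1) ^+ b *: pauli2 R P) ZZ).
- exact: pauli_group2_pauli2.
- by have := pauli_group2_pauli2 R false (PZ, PZ); rewrite expr0 scale1r.
- by rewrite -scalemxAl -scalemxAr pauli2_sqr scalerA -expr2 sqrr_sign scale1r.
- exact: pauli2_sqr.
- by rewrite -scalemxAl -scalemxAr pauli2_comm (negbTE comm) expr0 scale1r.
- by rewrite mxtraceZ mxtrace_pauli2; case: P {comb_P comm} P_neqI P_neqZZ => -[] [];
    rewrite ?mulr0.
- exact: mxtrace_pauli2.
- rewrite -scalemxAl mxtraceZ pauli2M mxtraceZ mxtrace_pauli2.
  by case: P {comb_P comm} P_neqI P_neqZZ => -[] []; rewrite /= ?mulr0.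
- by rewrite psi_code /code_op comb_P.
Qed.

Lemma stab_state_code_op_z (b : bool) : stab_state (code_op ((-1) ^+ b : R) 0 0).
Proof.
apply: (@stab_state_code_op b (PZ, PI) (psiRy (if b then pi else 0))) => //.
- rewrite [LHS]rhoRyE; case: b; first by rewrite cospi sinpi expr1.
  by rewrite cos0 sin0 expr0.
- by rewrite /pauli_comb !big_cons big_nil /= !rmorph0 !scale0r !addr0 rmorph_sign.
Qed.

Lemma stab_state_code_op_x (b : bool) : stab_state (code_op 0 ((-1) ^+ b : R) 0).
Proof.
apply: (@stab_state_code_op b (PX, PX) (psiRy ((-1) ^+ b * (pi / 2)))) => //.
- rewrite [LHS]rhoRyE; case: b; rewrite ?expr1 ?expr0 ?mulN1r ?mul1r.
    by rewrite cosN sinN cos_pihalf sin_pihalf.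
  by rewrite cos_pihalf sin_pihalf.
- rewrite /pauli_comb !big_cons big_nil /= !rmorph0 !scale0r.
  by rewrite add0r !addr0 rmorph_sign.
Qed.

Lemma stab_state_code_op_y (b : bool) : stab_state (code_op 0 0 ((-1) ^+ b : R)).
Proof.
apply: (@stab_state_code_op b (PX, PY) (psiRx (- ((-1) ^+ b * (pi / 2))))) => //.
- rewrite [LHS]rhoRxE sinN cosN opprK; case: b; rewrite ?expr1 ?expr0 ?mulN1r ?mul1r.
    by rewrite cosN sinN cos_pihalf sin_pihalf.
  by rewrite cos_pihalf sin_pihalf.
- rewrite /pauli_comb !big_cons big_nil /= !rmorph0 !scale0r.
  by rewrite !add0r !addr0 rmorph_sign.
Qed.

(* Opposite vertices get weights of sum p, q, r and of difference z, x, y, so all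
   choices with p + q + r = 1 decompose the same operator: p >= |z| makes the two
   weights nonnegative, p <= |z| makes the sum of their absolute values |z|. *)
Definition octahedron_comb (p q r z x y : R) : seq (R * Mat) :=
  [:: ((p + z) / 2, code_op 1 0 0); ((p - z) / 2, code_op (- 1) 0 0);
      ((q + x) / 2, code_op 0 1 0); ((q - x) / 2, code_op 0 (- 1) 0);
      ((r + y) / 2, code_op 0 0 1); ((r - y) / 2, code_op 0 0 (- 1))].

Lemma stab_state_octahedron_comb p q r z x y w :
  w \in octahedron_comb p q r z x y -> stab_state w.2.
Proof.
rewrite !inE => /or4P[/eqP->|/eqP->|/eqP->|/or3P[]/eqP->].
- exact: (stab_state_code_op_z false).
- exact: (stab_state_code_op_z true).
- exact: (stab_state_code_op_x false).
- exact: (stab_state_code_op_x true).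
- exact: (stab_state_code_op_y false).
- exact: (stab_state_code_op_y true).
Qed.

Let code_pauli P : Mat := rC 4^-1 *: (pauli2 R P *m (1%:M + ZZ)).

Let code_op_affine z x y : code_op z x y =
  code_pauli (PI, PI) + \sum_(t <- logical z x y) rC t.1 *: code_pauli t.2.
Proof.
rewrite /code_pauli pauli2_id mul1mx /code_op mulmxDl mul1mx scalerDr; congr (_ + _).
rewrite /pauli_comb mulmx_suml scaler_sumr; apply: eq_bigr => t _.
by rewrite -scalemxAl !scalerA mulrC.
Qed.

Lemma sum_antipodes (V : lmodType C) (N A : V) (q x : R) :
  rC ((q + x) / 2) *: (N + A) + rC ((q - x) / 2) *: (N - A) = rC q *: N + rC x *: A.
Proof.
rewrite scalerDr scalerBr addrACA -scalerDl -scalerBl -rmorphD -rmorphB.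
by congr (rC _ *: _ + rC _ *: _); field.
Qed.

Lemma sum_octahedron_comb p q r z x y : p + q + r = 1 ->
  \sum_(w <- octahedron_comb p q r z x y) rC w.1 *: w.2 = code_op z x y.
Proof.
move=> pqr; rewrite !big_cons big_nil !code_op_affine !big_cons !big_nil /=.
rewrite rmorph1 rmorphN1 rmorph0.
move: (code_pauli (PI, PI)) (code_pauli (PZ, PI)) (code_pauli (PX, PX))
  (code_pauli (PX, PY)) => N A B D.
rewrite !(@scale0r _ Mat) !scale1r !scaleN1r !add0r !addr0 addrA [X in _ + X]addrA.
rewrite !sum_antipodes [X in _ + X]addrACA -scalerDl addrACA -scalerDl.
by rewrite -!rmorphD [p + _]addrA pqr rmorph1 scale1r.
Qed.

End Octahedron.

(** * Extents and distances of code states *)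

Section CodeStateResources.
Variable R : realType.
Local Notation C := (complex.complex R).
Local Notation Mat := (matrix C (2 * 2) (2 * 2)).

Lemma W_free_octahedron (z x y : R) :
  `|z| + `|x| + `|y| <= 1 -> W_free (wigner (code_op z x y)).
Proof.
set t := _ + _ => t_le1; pose d := (1 - t) / 3.
exists (octahedron_comb (`|z| + d) (`|x| + d) (`|y| + d) z x y); split.
- move=> w w_in; split; last exact: stab_state_octahedron_comb w_in.
  have norm_bounds (r : R) : - `|r| <= r <= `|r| by rewrite -ler_norml.
  move: (norm_bounds z) (norm_bounds x) (norm_bounds y).
  move=> /andP[? ?] /andP[? ?] /andP[? ?].
  move: w_in; rewrite !inE /d => /or4P[/eqP->|/eqP->|/eqP->|/or3P[]/eqP->] /=; lra.
- by rewrite !big_cons big_nil /= /d /t; field.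
- move=> a; rewrite -(@sum_octahedron_comb _ (`|z| + d) (`|x| + d) (`|y| + d)).
    rewrite wignerE raddf_sum mulr_suml; apply: eq_bigr => w _ /=.
    by rewrite expectZ -mulrA -wignerE.
  by rewrite /d /t; field.
Qed.

Lemma stab_state_expect_logical (sigma : Mat) (a b c k : R) : stab_state sigma ->
  `|a| <= k -> `|b| <= k -> `|c| <= k ->
  `|expect sigma (pauli_comb (logical a b c))| <= k /\
  `|expect sigma (pauli_comb (logicalZZ a b c))| <= k.
Proof.
move=> st a_le b_le c_le; have k_ge0 := le_trans (normr_ge0 a) a_le.
by split; apply: stab_state_expect_anticomm_comb => //=; rewrite ?normrN a_le b_le c_le.
Qed.

Lemma stab_extent_code_op (z x y : R) : 1 <= `|z| + `|x| + `|y| ->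
  stab_extent (code_op z x y) = `|z| + `|x| + `|y|.
Proof.
set t := _ + _ => t_ge1; have t_gt0 : 0 < t := lt_le_trans ltr01 t_ge1.
apply: inf_minimum.
  exists (octahedron_comb (`|z| / t) (`|x| / t) (`|y| / t) z x y); split.
  - exact: stab_state_octahedron_comb.
  - by rewrite sum_octahedron_comb // -!mulrDl divff // gt_eqF.
  - have shrink (r : R) : `| `|r| / t | <= `|r|.
      by rewrite normrM normr_id gtr0_norm ?invr_gt0 // ler_pdivrMr // ler_peMr.
    rewrite !big_cons big_nil /= [_ + 0]addr0 addrA [X in _ + X]addrA.
    by rewrite !normr_half_add_sub // addrA.
move=> _ [l [lP lE ->]].
have tE : t = expect (code_op z x y) (pauli_comb
    (logical ((-1) ^+ (z < 0)%R) ((-1) ^+ (x < 0)%R) ((-1) ^+ (y < 0)%R))).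
  by rewrite (proj1 (expect_code_op _ _ _ _ _ _)) -!normrEsign.
rewrite tE; apply: stab_decomposition_l1_ge lP lE => sigma st.
by apply: (proj1 (stab_state_expect_logical st _ _ _)); rewrite normr_sign.
Qed.

Lemma W_free_l1dist_code_op_ge (a b c k z x y : R) f :
  `|b| <= 1 -> `|a| + `|c| <= 1 -> `|a| <= k -> `|b| <= k -> `|c| <= k ->
  W_free f -> a * z + b * x + c * y - k <= l1dist (wigner (code_op z x y)) f.
Proof.
move=> b_le1 ac_le1 a_le b_le c_le Wf.
have half_le (r : R) : `|r| <= k -> `|r / 2| <= k / 2.
  by rewrite normf_div normr_nat ler_pM2r ?invr_gt0.
have expect_code_terms (rho : Mat) :
    expect rho (pauli_comb (code_terms (a / 2) (b / 2) (c / 2))) =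
    expect rho (pauli_comb (logical (a / 2) (b / 2) (c / 2)))
    + expect rho (pauli_comb (logicalZZ (a / 2) (b / 2) (c / 2))).
  by rewrite [pauli_comb (code_terms _ _ _)]big_cat raddfD.
have -> : a * z + b * x + c * y =
    expect (code_op z x y) (pauli_comb (code_terms (a / 2) (b / 2) (c / 2))).
  have [expect_L expect_LZZ] := expect_code_op z x y (a / 2) (b / 2) (c / 2).
  by rewrite expect_code_terms expect_L expect_LZZ; field.
apply: W_free_l1dist_ge Wf => [p|sigma st]; last first.
  have [] := stab_state_expect_logical st (half_le _ a_le) (half_le _ b_le)
    (half_le _ c_le).
  by rewrite expect_code_terms !ler_norml => /andP[_ ?] /andP[_ ?]; lra.
rewrite norm_wigner_code_terms; case: ifP => _.
  have := ler_normD (a / 2) ((-1) ^+ (p.1.2 (+) p.2.2) * (c / 2)).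
  by rewrite (normrM (_ ^+ _)) normr_sign mul1r !normf_div normr_nat; lra.
by rewrite normf_div normr_nat; lra.
Qed.

Lemma wigner_distance_code_op_zx (z x : R) : `|z| <= 1 -> 1 <= `|z| + `|x| ->
  wigner_distance (code_op z x 0) = `|z| + `|x| - 1.
Proof.
move=> z_le1 zx_ge1; apply: inf_minimum; last first.
  move=> _ [f [Wf ->]].
  have := @W_free_l1dist_code_op_ge ((-1) ^+ (z < 0)%R) ((-1) ^+ (x < 0)%R) 0 1 z x 0 f.
  by rewrite !normr_sign normr0 !addr0 -!normrEsign mulr0 addr0 ler01; apply.
pose sgn_x : R := (-1) ^+ (x < 0)%R.
exists (wigner (code_op z (sgn_x * (1 - `|z|)) 0)); split.
  apply: W_free_octahedron; rewrite normrM normr_sign mul1r normr0 addr0.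
  by rewrite [`|1 - _|]ger0_norm ?subr_ge0 // addrC subrK.
rewrite l1dist_code_op !subrr normr0 maxxx addr0.
have -> : x - sgn_x * (1 - `|z|) = sgn_x * (`|z| + `|x| - 1).
  by rewrite [x in LHS]numEsign -/sgn_x; ring.
by rewrite normrM normr_sign mul1r ger0_norm // subr_ge0.
Qed.

Lemma wigner_distance_code_op_zy (z y : R) : `|z| <= 1 -> `|y| <= 1 ->
  1 <= `|z| + `|y| -> wigner_distance (code_op z 0 y) = 2^-1 * (`|z| + `|y| - 1).
Proof.
move=> z_le1 y_le1 zy_ge1; apply: inf_minimum; last first.
  move=> _ [f [Wf ->]].
  have := @W_free_l1dist_code_op_ge (2^-1 * (-1) ^+ (z < 0)%R) 0
    (2^-1 * (-1) ^+ (y < 0)%R) 2^-1 z 0 y f.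
  rewrite !normrM !normr_sign normfV normr_nat normr0 mulr0 addr0 -!mulrA -!normrEsign.
  by rewrite mulrBr mulrDr mulr1; apply => //; lra.
pose shift := 2^-1 * (`|z| + `|y| - 1).
pose sgn_z : R := (-1) ^+ (z < 0)%R; pose sgn_y : R := (-1) ^+ (y < 0)%R.
have zE : z - sgn_z * shift = sgn_z * (`|z| - shift).
  by rewrite [z in LHS]numEsign -/sgn_z; ring.
have yE : y - sgn_y * shift = sgn_y * (`|y| - shift).
  by rewrite [y in LHS]numEsign -/sgn_y; ring.
have [shift_ge0 shift_le_z shift_le_y] : [/\ 0 <= shift, shift <= `|z| & shift <= `|y|].
  by rewrite /shift; split; lra.
exists (wigner (code_op (z - sgn_z * shift) 0 (y - sgn_y * shift))); split.
  apply: W_free_octahedron; rewrite zE yE !normrM !normr_sign !mul1r normr0 addr0.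
  rewrite [`| `|z| - shift|]ger0_norm ?subr_ge0 //.
  rewrite [`| `|y| - shift|]ger0_norm ?subr_ge0 //.
  by rewrite /shift; lra.
rewrite l1dist_code_op subrr normr0 add0r ![_ - (_ - _)]subKr.
by rewrite !(normrM _ shift) !normr_sign !mul1r maxxx ger0_norm.
Qed.

End CodeStateResources.

Theorem theorem5p1 (R : realType) (theta : R) :
  0 < theta < pi ->
  [/\ wigner_distance (rhoRy theta) = `|sin theta| + `|cos theta| - 1,
      wigner_distance (rhoRx theta) = 2^-1 * (`|sin theta| + `|cos theta| - 1),
      stab_extent (rhoRy theta) = `|sin theta| + `|cos theta|
    & stab_extent (rhoRx theta) = `|sin theta| + `|cos theta|] /\
  ((0 < wigner_distance (rhoRy theta) -> tightness (rhoRy theta) = 1) /\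
   (0 < wigner_distance (rhoRx theta) -> tightness (rhoRx theta) = 2)).
Proof.
move=> _; have ge1 := norm_cos_sin_ge1 theta.
have distRy : wigner_distance (rhoRy theta) = `|sin theta| + `|cos theta| - 1.
  by rewrite rhoRyE wigner_distance_code_op_zx ?cos_max // (addrC `|cos _|).
have distRx : wigner_distance (rhoRx theta) = 2^-1 * (`|sin theta| + `|cos theta| - 1).
  by rewrite rhoRxE wigner_distance_code_op_zy ?normrN ?cos_max ?sin_max //
    (addrC `|cos _|).
have extentRy : stab_extent (rhoRy theta) = `|sin theta| + `|cos theta|.
  by rewrite rhoRyE stab_extent_code_op normr0 addr0 // addrC.
have extentRx : stab_extent (rhoRx theta) = `|sin theta| + `|cos theta|.
  by rewrite rhoRxE stab_extent_code_op normr0 addr0 normrN // addrC.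
split=> //; split; rewrite /tightness ?distRy ?distRx ?extentRy ?extentRx => pos.
  by rewrite divff // gt_eqF.
by move: pos; rewrite pmulr_rgt0 ?invr_gt0 // => /lt0r_neq0 ?; field.
Qed.
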